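(* Let $\mathbb{K}$ be an algebraically closed field of characteristic not $2$ and $d\ge 0$ an integer. Each parameter array of diameter $d$ over $\mathbb{K}$ belonging to one of Terwilliger's families listed in the context (Racah, Hahn, dual Hahn, Krawtchouk, Bannai-Ito) can be transformed by an affine transformation $$\theta_i\mapsto t\theta_i+c,\quad \theta_i^*\mapsto t^*\theta_i^*+c^*,\quad \varphi_i\mapsto tt^*\varphi_i,\quad \phi_i\mapsto tt^*\phi_i\qquad(c,c^*,t,t^*\in\mathbb{K},\ t,t^*\ne0)$$ to the following form, according to its family ($0\le i\le d$ for $\theta_i,\theta_i^*$; $1\le i\le d$ for $\varphi_i,\phi_i$): - Racah: $\theta_i=(i+u)(i+u+1)$, $\theta_i^*=(i+u^* )(i+u^*+1)$, $\varphi_i=i(i-d-1)(i+u+u^*-v)(i+u+u^*+d+1+v)$, $\phi_i=i(i-d-1)(i-u+u^*+v)(i-u+u^*-d-1-v)$. - Hahn: $\theta_i=i+v-\frac d2$, $\theta_i^*=(i+u^* )(i+u^*+1)$, $\varphi_i=i(i-d-1)(i+u^*+2v)$, $\phi_i=-i(i-d-1)(i+u^*-2v)$. - Dual Hahn: $\theta_i=(i+u)(i+u+1)$, $\theta_i^*=i+v-\frac d2$, $\varphi_i=i(i-d-1)(i+u+2v)$, $\phi_i=i(i-d-1)(i-u+2v-d-1)$. - Krawtchouk: $\theta_i=i-\frac d2$, $\theta_i^*=i-\frac d2$, $\varphi_i=v\,i(i-d-1)$, $\phi_i=(v-1)\,i(i-d-1)$. - Bannai-Ito: $\theta_i=(-1)^i\left(i+u-\frac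 d2\right)$, $\theta_i^*=(-1)^i\left(i+u^*-\frac d2\right)$, $$\varphi_i=\begin{cases}-i\left(i+u+u^*+v-\frac{d+1}2\right),& i\text{ even},\ d\text{ even},\\ -(i-d-1)\left(i+u+u^*-v-\frac{d+1}2\right),& i\text{ odd},\ d\text{ even},\\ -i(i-d-1),& i\text{ even},\ d\text{ odd},\\ v^2-\left(i+u+u^*-\frac{d+1}2\right)^2,& i\text{ odd},\ d\text{ odd},\end{cases}$$ $$\phi_i=\begin{cases}i\left(i-u+u^*-v-\frac{d+1}2\right),& i\text{ even},\ d\text{ even},\\ (i-d-1)\left(i-u+u^*+v-\frac{d+1}2\right),& i\text{ odd},\ d\text{ even},\\ -i(i-d-1),& i\text{ even},\ d\text{ odd},\\ v^2-\left(i-u+u^*-\frac{d+1}2\right)^2,& i\text{ odd},\ d\text{ odd}.\end{cases}$$ In each case, $u,u^*,v$ (those that occur) are scalars in $\mathbb{K}$ such that $\theta_i\neq\theta_j$, $\theta_i^*\neq\theta_j^*$ for $0\le i<j\le d$, and $\varphi_i\ne0$, $\phi_i\neq0$ for $1\le i\le d$.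
   Context: A parameter array over $\mathbb{K}$ of diameter $d$ is a sequence $(\theta_0,\ldots,\theta_d;\theta_0^*,\ldots,\theta_d^*;\varphi_1,\ldots,\varphi_d;\phi_1,\ldots,\phi_d)$ of scalars in $\mathbb{K}$ such that: PA1. $\theta_i\neq\theta_j$, $\theta_i^*\ne\theta_j^*$ for $i\neq j$, $0\le i,j\le d$. PA2. $\varphi_i\ne0$, $\phi_i\ne0$ for $1\le i\le d$. PA3. $\varphi_i=\phi_1\sum_{j=0}^{i-1}\frac{\theta_j-\theta_{d-j}}{\theta_0-\theta_d}+(\theta_i^*-\theta_0^* )(\theta_{i-1}-\theta_d)$ for $1\le i\le d$. PA4. $\phi_i=\varphi_1\sum_{j=0}^{i-1}\frac{\theta_j-\theta_{d-j}}{\theta_0-\theta_d}+(\theta_i^*-\theta_0^* )(\theta_{d-i+1}-\theta_0)$ for $1\le i\le d$. PA5. $\frac{\theta_{i-2}-\theta_{i+1}}{\theta_{i-1}-\theta_i}$ and $\frac{\theta^*_{i-2}-\theta^*_{i+1}}{\theta^*_{i-1}-\theta^*_i}$ are equal and independent of $i$ for $2\le i\le d-1$. Terwilliger's families: parameter arrays of the following forms, with $\theta_0,\theta_0^*\in\mathbb{K}$ arbitrary and the other parameters in $\mathbb{K}$ as indicated. - Racah ($h,h^*\neq0$; $r_1+r_2=s+s^*+d+1$): $\theta_i=\theta_0+hi(i+1+s)$, $\theta_i^*=\theta_0^*+h^*i(i+1+s^* )$, $\varphi_i=hh^*i(i-d-1)(i+r_1)(i+r_2)$, $\phi_i=hh^*i(i-d-1)(i+s^*-r_1)(i+s^*-r_2)$.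 - Hahn ($h^*,s\neq0$): $\theta_i=\theta_0+si$, $\theta_i^*=\theta_0^*+h^*i(i+1+s^* )$, $\varphi_i=h^*s\,i(i-d-1)(i+r)$, $\phi_i=-h^*s\,i(i-d-1)(i+s^*-r)$. - Dual Hahn ($h,s^*\ne0$): $\theta_i=\theta_0+hi(i+1+s)$, $\theta_i^*=\theta_0^*+s^*i$, $\varphi_i=hs^*i(i-d-1)(i+r)$, $\phi_i=hs^*i(i-d-1)(i+r-s-d-1)$. - Krawtchouk ($r,s,s^*\neq0$): $\theta_i=\theta_0+si$, $\theta_i^*=\theta_0^*+s^*i$, $\varphi_i=r\,i(i-d-1)$, $\phi_i=(r-ss^* )\,i(i-d-1)$. - Bannai-Ito ($h,h^*\neq0$; $r_1+r_2=-s-s^*+d+1$): $\theta_i=\theta_0+h(s-1+(1-s+2i)(-1)^i)$, $\theta_i^*=\theta_0^*+h^*(s^*-1+(1-s^*+2i)(-1)^i)$; $\varphi_i/(hh^* )$ equals $-4i(i+r_1)$ for $i$ even, $d$ even; $-4(i-d-1)(i+r_2)$ for $i$ odd, $d$ even; $-4i(i-d-1)$ for $i$ even, $d$ odd; $-4(i+r_1)(i+r_2)$ for $i$ odd, $d$ odd; and $\phi_i/(hh^* )$ equals $4i(i-s^*-r_1)$ for $i$ even, $d$ even; $4(i-d-1)(i-s^*-r_2)$ for $i$ odd, $d$ even; $-4i(i-d-1)$ for $i$ even, $d$ odd; $-4(i-s^*-r_1)(i-s^*-r_2)$ for $i$ odd, $d$ odd. *)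

(* Defs.v *)
From HB Require Import structures.
From mathcomp Require Import all_boot all_order all_algebra.

Set Implicit Arguments.
Unset Strict Implicit.
Unset Printing Implicit Defensive.

Import GRing.Theory.
Local Open Scope ring_scope.

(* Sequences (theta_0..theta_d; theta*_0..theta*_d; varphi_1..varphi_d;
   phi_1..phi_d).  The tuples of varphi's and phi's start at index 1, so the
   entry at position k is varphi_(k+1), resp. phi_(k+1). *)
Record scalar_array (K : fieldType) (d : nat) := ScalarArray {
  theta_seq : d.+1.-tuple K;
  theta_star_seq : d.+1.-tuple K;
  varphi_seq : d.-tuple K;
  phi_seq : d.-tuple K }.

(* Entries with the mathematical indices; only meaningful for 0 <= i <= d
   for theta and theta_star, resp. 1 <= i <= d for varphi and phi. *)
Definition theta (K : fieldType) (d : nat) (p : scalar_array K d) (i : nat) : K :=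
  nth 0 (theta_seq p) i.
Definition theta_star (K : fieldType) (d : nat) (p : scalar_array K d) (i : nat) : K :=
  nth 0 (theta_star_seq p) i.
Definition varphi (K : fieldType) (d : nat) (p : scalar_array K d) (i : nat) : K :=
  nth 0 (varphi_seq p) i.-1.
Definition phi (K : fieldType) (d : nat) (p : scalar_array K d) (i : nat) : K :=
  nth 0 (phi_seq p) i.-1.

Definition mk_array (K : fieldType) (d : nat) (th ths vph ph : nat -> K) :
    scalar_array K d :=
  ScalarArray [tuple th i | i < d.+1] [tuple ths i | i < d.+1]
              [tuple vph i.+1 | i < d] [tuple ph i.+1 | i < d].

Definition PA1 (K : fieldType) (d : nat) (p : scalar_array K d) : Prop :=
  forall i j : nat, (i <= d)%N -> (j <= d)%N -> i <> j ->
    theta p i <> theta p j /\ theta_star p i <> theta_star p j.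

Definition PA2 (K : fieldType) (d : nat) (p : scalar_array K d) : Prop :=
  forall i : nat, (1 <= i <= d)%N -> varphi p i <> 0 /\ phi p i <> 0.

Definition theta_sum (K : fieldType) (d : nat) (p : scalar_array K d) (i : nat) : K :=
  \sum_(0 <= j < i) (theta p j - theta p (d - j)) / (theta p 0 - theta p d).

Definition PA3 (K : fieldType) (d : nat) (p : scalar_array K d) : Prop :=
  forall i : nat, (1 <= i <= d)%N ->
    varphi p i = phi p 1 * theta_sum p i
      + (theta_star p i - theta_star p 0) * (theta p (i - 1) - theta p d).

Definition PA4 (K : fieldType) (d : nat) (p : scalar_array K d) : Prop :=
  forall i : nat, (1 <= i <= d)%N ->
    phi p i = varphi p 1 * theta_sum p i
      + (theta_star p i - theta_star p 0) * (theta p (d - i + 1) - theta p 0).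

Definition step_ratio (K : fieldType) (f : nat -> K) (i : nat) : K :=
  (f (i - 2)%N - f (i + 1)%N) / (f (i - 1)%N - f i).

Definition PA5 (K : fieldType) (d : nat) (p : scalar_array K d) : Prop :=
  exists c : K, forall i : nat, (2 <= i <= d - 1)%N ->
    step_ratio (theta p) i = c /\ step_ratio (theta_star p) i = c.

Definition parameter_array (K : fieldType) (d : nat) (p : scalar_array K d) : Prop :=
  [/\ PA1 p, PA2 p, PA3 p, PA4 p & PA5 p].

Definition affine_transform (K : fieldType) (d : nat) (t c ts cs : K) (p : scalar_array K d) :
    scalar_array K d :=
  mk_array d (fun i => t * theta p i + c) (fun i => ts * theta_star p i + cs)
    (fun i => t * ts * varphi p i) (fun i => t * ts * phi p i).

Definition affine_to (K : fieldType) (d : nat) (p q : scalar_array K d) : Prop :=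
  exists t c ts cs : K, [/\ t <> 0, ts <> 0 & affine_transform t c ts cs p = q].

(* Below, hs, ss and us stand for h^*, s^* and u^*, and th0, ths0 for theta_0
   and theta^*_0. *)

Definition racah (K : fieldType) (d : nat) (p : scalar_array K d) : Prop :=
  exists th0 ths0 h hs s ss r1 r2 : K,
  [/\ h <> 0, hs <> 0, r1 + r2 = s + ss + d%:R + 1 &
    p = mk_array d
      (fun i => th0 + h * i%:R * (i%:R + 1 + s))
      (fun i => ths0 + hs * i%:R * (i%:R + 1 + ss))
      (fun i => h * hs * i%:R * (i%:R - d%:R - 1) * (i%:R + r1) * (i%:R + r2))
      (fun i => h * hs * i%:R * (i%:R - d%:R - 1)
                * (i%:R + ss - r1) * (i%:R + ss - r2))].

Definition hahn (K : fieldType) (d : nat) (p : scalar_array K d) : Prop :=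
  exists th0 ths0 hs s ss r : K,
  [/\ hs <> 0, s <> 0 &
    p = mk_array d
      (fun i => th0 + s * i%:R)
      (fun i => ths0 + hs * i%:R * (i%:R + 1 + ss))
      (fun i => hs * s * i%:R * (i%:R - d%:R - 1) * (i%:R + r))
      (fun i => - hs * s * i%:R * (i%:R - d%:R - 1) * (i%:R + ss - r))].

Definition dual_hahn (K : fieldType) (d : nat) (p : scalar_array K d) : Prop :=
  exists th0 ths0 h s ss r : K,
  [/\ h <> 0, ss <> 0 &
    p = mk_array d
      (fun i => th0 + h * i%:R * (i%:R + 1 + s))
      (fun i => ths0 + ss * i%:R)
      (fun i => h * ss * i%:R * (i%:R - d%:R - 1) * (i%:R + r))
      (fun i => h * ss * i%:R * (i%:R - d%:R - 1)
                * (i%:R + r - s - d%:R - 1))].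

Definition krawtchouk (K : fieldType) (d : nat) (p : scalar_array K d) : Prop :=
  exists th0 ths0 r s ss : K,
  [/\ r <> 0, s <> 0, ss <> 0 &
    p = mk_array d
      (fun i => th0 + s * i%:R)
      (fun i => ths0 + ss * i%:R)
      (fun i => r * i%:R * (i%:R - d%:R - 1))
      (fun i => (r - s * ss) * i%:R * (i%:R - d%:R - 1))].

Definition bannai_ito (K : fieldType) (d : nat) (p : scalar_array K d) : Prop :=
  exists th0 ths0 h hs s ss r1 r2 : K,
  [/\ h <> 0, hs <> 0, r1 + r2 = - s - ss + d%:R + 1 &
    p = mk_array d
      (fun i => th0 + h * (s - 1 + (1 - s + 2%:R * i%:R) * (-1) ^+ i))
      (fun i => ths0 + hs * (ss - 1 + (1 - ss + 2%:R * i%:R) * (-1) ^+ i))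
      (fun i => h * hs *
        (if ~~ odd d then
           if ~~ odd i then - 4%:R * i%:R * (i%:R + r1)
           else - 4%:R * (i%:R - d%:R - 1) * (i%:R + r2)
         else
           if ~~ odd i then - 4%:R * i%:R * (i%:R - d%:R - 1)
           else - 4%:R * (i%:R + r1) * (i%:R + r2)))
      (fun i => h * hs *
        (if ~~ odd d then
           if ~~ odd i then 4%:R * i%:R * (i%:R - ss - r1)
           else 4%:R * (i%:R - d%:R - 1) * (i%:R - ss - r2)
         else
           if ~~ odd i then - 4%:R * i%:R * (i%:R - d%:R - 1)
           else - 4%:R * (i%:R - ss - r1) * (i%:R - ss - r2)))].

Definition racah_form (K : fieldType) (d : nat) (u us v : K) : scalar_array K d :=
  mk_array d
    (fun i => (i%:R + u) * (i%:R + u + 1))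
    (fun i => (i%:R + us) * (i%:R + us + 1))
    (fun i => i%:R * (i%:R - d%:R - 1)
              * (i%:R + u + us - v) * (i%:R + u + us + d%:R + 1 + v))
    (fun i => i%:R * (i%:R - d%:R - 1)
              * (i%:R - u + us + v) * (i%:R - u + us - d%:R - 1 - v)).

Definition hahn_form (K : fieldType) (d : nat) (us v : K) : scalar_array K d :=
  mk_array d
    (fun i => i%:R + v - d%:R / 2%:R)
    (fun i => (i%:R + us) * (i%:R + us + 1))
    (fun i => i%:R * (i%:R - d%:R - 1) * (i%:R + us + 2%:R * v))
    (fun i => - i%:R * (i%:R - d%:R - 1) * (i%:R + us - 2%:R * v)).

Definition dual_hahn_form (K : fieldType) (d : nat) (u v : K) : scalar_array K d :=
  mk_array d
    (fun i => (i%:R + u) * (i%:R + u + 1))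
    (fun i => i%:R + v - d%:R / 2%:R)
    (fun i => i%:R * (i%:R - d%:R - 1) * (i%:R + u + 2%:R * v))
    (fun i => i%:R * (i%:R - d%:R - 1) * (i%:R - u + 2%:R * v - d%:R - 1)).

Definition krawtchouk_form (K : fieldType) (d : nat) (v : K) : scalar_array K d :=
  mk_array d
    (fun i => i%:R - d%:R / 2%:R)
    (fun i => i%:R - d%:R / 2%:R)
    (fun i => v * i%:R * (i%:R - d%:R - 1))
    (fun i => (v - 1) * i%:R * (i%:R - d%:R - 1)).

Definition bannai_ito_form (K : fieldType) (d : nat) (u us v : K) : scalar_array K d :=
  mk_array d
    (fun i => (-1) ^+ i * (i%:R + u - d%:R / 2%:R))
    (fun i => (-1) ^+ i * (i%:R + us - d%:R / 2%:R))
    (fun i =>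
      if ~~ odd d then
        if ~~ odd i then - i%:R * (i%:R + u + us + v - (d%:R + 1) / 2%:R)
        else - (i%:R - d%:R - 1) * (i%:R + u + us - v - (d%:R + 1) / 2%:R)
      else
        if ~~ odd i then - i%:R * (i%:R - d%:R - 1)
        else v ^+ 2 - (i%:R + u + us - (d%:R + 1) / 2%:R) ^+ 2)
    (fun i =>
      if ~~ odd d then
        if ~~ odd i then i%:R * (i%:R - u + us - v - (d%:R + 1) / 2%:R)
        else (i%:R - d%:R - 1) * (i%:R - u + us + v - (d%:R + 1) / 2%:R)
      else
        if ~~ odd i then - i%:R * (i%:R - d%:R - 1)
        else v ^+ 2 - (i%:R - u + us - (d%:R + 1) / 2%:R) ^+ 2).

Definition nondegenerate_array (K : fieldType) (d : nat) (p : scalar_array K d) : Prop :=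
  (forall i j : nat, (0 <= i < j)%N -> (j <= d)%N ->
     theta p i <> theta p j /\ theta_star p i <> theta_star p j) /\
  (forall i : nat, (1 <= i <= d)%N -> varphi p i <> 0 /\ phi p i <> 0).

(* Main.v *)
(** The scalings t and t* are forced by the leading coefficients of theta_i and
    theta*_i, and u, u* by completing the square (for Bannai-Ito, by factoring
    (-1)^i out of theta_i and theta*_i).  In each family the constraint on
    r_1 + r_2 (if any) leaves one free parameter in varphi_i and phi_i, which
    becomes v.  Affine maps with t, t* nonzero preserve PA1 and PA2, whence the
    nondegeneracy of the normal form. *)
Require Import Defs.
From HB Require Import structures.
From mathcomp Require Import all_boot all_order all_algebra.
From mathcomp Require Import ring.

Set Implicit Arguments.
Unset Strict Implicit.
Unset Printing Implicit Defensive.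

Import GRing.Theory.
Local Open Scope ring_scope.

Lemma nth_mktuple_nat (T : Type) (x0 : T) (n : nat) (f : nat -> T) (i : nat) :
  (i < n)%N -> nth x0 [tuple f j | j < n] i = f i.
Proof. by move=> lt_in; rewrite (nth_mktuple (fun j => f j) x0 (Ordinal lt_in)). Qed.

Section MkArray.

Variables (K : fieldType) (d : nat) (th ths vph ph : nat -> K).
Let q := mk_array d th ths vph ph.

Lemma theta_mk_array i : (i <= d)%N -> theta q i = th i.
Proof. by move=> le_id; rewrite /theta nth_mktuple_nat. Qed.

Lemma theta_star_mk_array i : (i <= d)%N -> theta_star q i = ths i.
Proof. by move=> le_id; rewrite /theta_star nth_mktuple_nat. Qed.

(** Index 0 has to be excluded: [0.-1] is [0], so it would read the entry of index 1. *)
Lemma varphi_mk_array i : (1 <= i <= d)%N -> varphi q i = vph i.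
Proof. by case: i => // i; exact: (nth_mktuple_nat _ (fun j => vph j.+1)). Qed.

Lemma phi_mk_array i : (1 <= i <= d)%N -> phi q i = ph i.
Proof. by case: i => // i; exact: (nth_mktuple_nat _ (fun j => ph j.+1)). Qed.

End MkArray.

(** An array stores only the entries at meaningful indices, so agreement there suffices. This
    reduces each normal form to four scalar identities in [i]. *)
Lemma eq_mk_array (K : fieldType) (d : nat)
    (th ths vph ph th' ths' vph' ph' : nat -> K) :
    (forall i, (i <= d)%N -> th i = th' i) ->
    (forall i, (i <= d)%N -> ths i = ths' i) ->
    (forall i, (1 <= i <= d)%N -> vph i = vph' i) ->
    (forall i, (1 <= i <= d)%N -> ph i = ph' i) ->
  mk_array d th ths vph ph = mk_array d th' ths' vph' ph'.
Proof.
move=> eq_th eq_ths eq_vph eq_ph; congr ScalarArray; apply: eq_mktuple => i.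
- by apply: eq_th; rewrite -ltnS ltn_ord.
- by apply: eq_ths; rewrite -ltnS ltn_ord.
- by apply: eq_vph; rewrite /= ltn_ord.
- by apply: eq_ph; rewrite /= ltn_ord.
Qed.

Lemma affine_mk_array (K : fieldType) (d : nat) (t c ts cs : K)
    (th ths vph ph : nat -> K) :
  affine_transform t c ts cs (mk_array d th ths vph ph) =
  mk_array d (fun i => t * th i + c) (fun i => ts * ths i + cs)
    (fun i => t * ts * vph i) (fun i => t * ts * ph i).
Proof.
apply: eq_mk_array => i le_id.
- by rewrite theta_mk_array.
- by rewrite theta_star_mk_array.
- by rewrite varphi_mk_array.
- by rewrite phi_mk_array.
Qed.

Lemma affine_to_nondegenerate (K : fieldType) (d : nat) (p q : scalar_array K d) :
  PA1 p -> PA2 p -> affine_to p q -> nondegenerate_array q.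
Proof.
move=> pa1 pa2 [t [c [ts [cs [/eqP t0 /eqP ts0 <-]]]]]; split=> [i j|i].
  move=> /= lt_ij le_jd; have le_id : (i <= d)%N by rewrite ltnW // (leq_trans lt_ij).
  have [|th_ne ths_ne] := pa1 i j le_id le_jd.
    by move=> eq_ij; rewrite eq_ij ltnn in lt_ij.
  rewrite !theta_mk_array // !theta_star_mk_array //.
  by split=> /addIr /mulfI eq_ij; [apply/th_ne/eq_ij | apply/ths_ne/eq_ij].
move=> i_bounds; have [/eqP vph0 /eqP ph0] := pa2 i i_bounds.
by rewrite varphi_mk_array // phi_mk_array //; split; apply/eqP; rewrite !mulf_neq0.
Qed.

Lemma racah_affine (K : fieldType) (d : nat) (p : scalar_array K d) :
  2%:R != 0 :> K -> racah p -> exists u us v : K, affine_to p (racah_form d u us v).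
Proof.
move=> two0 [th0 [ths0 [h [hs [s [ss [r1 [r2 [/eqP h0 /eqP hs0 r_sum ->]]]]]]]]].
(* Once [r2] is eliminated, the remaining parameters are free of relations and [field] can decide
   the identities. *)
have -> : r2 = s + ss + d%:R + 1 - r1 by rewrite -r_sum addrC addKr.
(* The linear coefficient of [theta] gives [2u = s]. The choice of [v] turns [i + u + us - v] into
   [i + r1]; the other factor of [varphi] is then [i + r2]. *)
exists (s / 2%:R), (ss / 2%:R), (s / 2%:R + ss / 2%:R - r1).
(* The translation matches the values at [i = 0]. *)
exists h^-1, (s / 2%:R * (s / 2%:R + 1) - th0 / h).
exists hs^-1, (ss / 2%:R * (ss / 2%:R + 1) - ths0 / hs).
split; [exact/eqP/invr_neq0 | exact/eqP/invr_neq0 |].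
by rewrite affine_mk_array; apply: eq_mk_array => i _; field; rewrite ?h0 ?hs0 two0.
Qed.

Lemma hahn_affine (K : fieldType) (d : nat) (p : scalar_array K d) :
  2%:R != 0 :> K -> hahn p -> exists us v : K, affine_to p (hahn_form d us v).
Proof.
move=> two0 [th0 [ths0 [hs [s [ss [r [/eqP hs0 /eqP s0 ->]]]]]]].
(* Solves [us + 2v = r], as [varphi] requires; the shift by [v] in [theta] is absorbed by the
   translation. *)
pose v := (r - ss / 2%:R) / 2%:R.
exists (ss / 2%:R), v.
exists s^-1, (v - d%:R / 2%:R - th0 / s).
exists hs^-1, (ss / 2%:R * (ss / 2%:R + 1) - ths0 / hs).
split; [exact/eqP/invr_neq0 | exact/eqP/invr_neq0 |].
by rewrite affine_mk_array; apply: eq_mk_array => i _; rewrite /v;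
  field; rewrite ?s0 ?hs0 two0.
Qed.

Lemma dual_hahn_affine (K : fieldType) (d : nat) (p : scalar_array K d) :
  2%:R != 0 :> K -> dual_hahn p -> exists u v : K, affine_to p (dual_hahn_form d u v).
Proof.
move=> two0 [th0 [ths0 [h [s [ss [r [/eqP h0 /eqP ss0 ->]]]]]]].
(* Solves [u + 2v = r]; here the translation of [theta_star] absorbs [v]. *)
pose v := (r - s / 2%:R) / 2%:R.
exists (s / 2%:R), v.
exists h^-1, (s / 2%:R * (s / 2%:R + 1) - th0 / h).
exists ss^-1, (v - d%:R / 2%:R - ths0 / ss).
split; [exact/eqP/invr_neq0 | exact/eqP/invr_neq0 |].
by rewrite affine_mk_array; apply: eq_mk_array => i _; rewrite /v;
  field; rewrite ?h0 ?ss0 two0.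
Qed.

Lemma krawtchouk_affine (K : fieldType) (d : nat) (p : scalar_array K d) :
  2%:R != 0 :> K -> krawtchouk p -> exists v : K, affine_to p (krawtchouk_form d v).
Proof.
move=> two0 [th0 [ths0 [r [s [ss [_ /eqP s0 /eqP ss0 ->]]]]]].
(* Dividing by [s * ss] sends [r] to [v] and [r - s * ss] to [v - 1]. *)
exists (r / (s * ss)).
exists s^-1, (- (d%:R / 2%:R) - th0 / s), ss^-1, (- (d%:R / 2%:R) - ths0 / ss).
split; [exact/eqP/invr_neq0 | exact/eqP/invr_neq0 |].
by rewrite affine_mk_array; apply: eq_mk_array => i _; field; rewrite ?s0 ?ss0 ?two0.
Qed.

Lemma bannai_ito_affine (K : fieldType) (d : nat) (p : scalar_array K d) :
  2%:R != 0 :> K -> bannai_ito p ->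
  exists u us v : K, affine_to p (bannai_ito_form d u us v).
Proof.
move=> two0 [th0 [ths0 [h [hs [s [ss [r1 [r2 [/eqP h0 /eqP hs0 r_sum ->]]]]]]]]].
have -> : r2 = - s - ss + d%:R + 1 - r1 by rewrite -r_sum addrC addKr.
exists ((1 - s + d%:R) / 2%:R), ((1 - ss + d%:R) / 2%:R).
(* This is [(r1 - r2) / 2], while [u + us - (d + 1) / 2] is [(r1 + r2) / 2]: their sum is [r1], and
   the second minus the first is [r2]. *)
exists (r1 - (- s - ss + d%:R + 1) / 2%:R).
exists (2%:R * h)^-1, ((1 - s) / 2%:R - th0 / (2%:R * h)).
exists (2%:R * hs)^-1, ((1 - ss) / 2%:R - ths0 / (2%:R * hs)).
split; [exact/eqP/invr_neq0/mulf_neq0 | exact/eqP/invr_neq0/mulf_neq0 |].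
rewrite affine_mk_array; apply: eq_mk_array => i _.
(* The identity is linear in [(-1) ^+ i], so it holds for both parities at once. *)
- by field; rewrite h0 two0.
- by field; rewrite hs0 two0.
(* For [d] and [i] odd, the product of the two factors becomes a difference of squares. *)
- by case: (odd d); case: (odd i) => /=; field; rewrite ?h0 ?hs0 two0.
- by case: (odd d); case: (odd i) => /=; field; rewrite ?h0 ?hs0 two0.
Qed.

Theorem lemma7p1 (K : closedFieldType) (char_neq2 : 2%N \notin [pchar K])
    (d : nat) (p : scalar_array K d) (p_PA : parameter_array p) :
  [/\ (racah p -> exists u us v : K,
         affine_to p (racah_form d u us v)
         /\ nondegenerate_array (racah_form d u us v)),
      (hahn p -> exists us v : K,
         affine_to p (hahn_form d us v)
         /\ nondegenerate_array (hahn_form d us v)),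
      (dual_hahn p -> exists u v : K,
         affine_to p (dual_hahn_form d u v)
         /\ nondegenerate_array (dual_hahn_form d u v)),
      (krawtchouk p -> exists v : K,
         affine_to p (krawtchouk_form d v)
         /\ nondegenerate_array (krawtchouk_form d v)) &
      (bannai_ito p -> exists u us v : K,
         affine_to p (bannai_ito_form d u us v)
         /\ nondegenerate_array (bannai_ito_form d u us v))].
Proof.
have two0 : 2%:R != 0 :> K by move: char_neq2; rewrite inE.
case: p_PA => pa1 pa2 _ _ _.
(* Every [q] reached from [p] inherits nondegeneracy, so each family only has to supply its affine
   map. *)
have nondeg q (pq : affine_to p q) := conj pq (affine_to_nondegenerate pa1 pa2 pq).
split.
- by case/(racah_affine two0) => u [us [v /nondeg]]; exists u, us, v.
- by case/(hahn_affine two0) => us [v /nondeg]; exists us, v.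
- by case/(dual_hahn_affine two0) => u [v /nondeg]; exists u, v.
- by case/(krawtchouk_affine two0) => v /nondeg; exists v.
- by case/(bannai_ito_affine two0) => u [us [v /nondeg]]; exists u, us, v.
Qed.
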